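(* Let $\mathcal{F}$ be a family of $n$ pseudo-discs in the plane all containing a common point $O$ in their interior. Then for every $k$ we have $g(\mathcal{F},k)\le 2(k-1)n$.
   Context: A family $\mathcal{F}$ of sets in the plane is nice if every member is a region bounded by a simple closed Jordan curve and these boundary curves are in general position: any two cross in only finitely many points, no two curves touch or overlap, and no three curves pass through a common point. A nice family is a family of pseudo-discs if the boundaries of every two of its members intersect in at most two points. For a family $\mathcal{F}$ of pseudo-discs and an integer $k$, $g(\mathcal{F},k)$ denotes the number of intersection points of two boundaries of sets in $\mathcal{F}$ that are contained in at most $k$ sets from $\mathcal{F}$.
   Formalization: The claim is stated for integers k ≥ 1 only: for k ≤ 0 and n ≥ 1 the bound 2(k-1)n is negative while g(F,k) ≥ 0, so the inequality fails there (for example one disc and k = 0). *)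

(* Defs.v *)
From mathcomp Require Import all_boot all_order all_algebra.
From mathcomp Require Import all_classical all_reals all_analysis.
Set Implicit Arguments. Unset Strict Implicit. Unset Printing Implicit Defensive.
Import Order.TTheory GRing.Theory Num.Theory.
Import numFieldNormedType.Exports.
Local Open Scope classical_set_scope.
Local Open Scope ring_scope.

Section Defs.
Variable R : realType.
Local Notation P := (R * R)%type.

Definition plane_bounded (A : set P) : Prop :=
  exists M : R, forall p, A p -> `|p.1| <= M /\ `|p.2| <= M.

Definition jordan_param (gamma : R -> P) : Prop :=
  continuous gamma /\ (forall t, gamma (t + 1) = gamma t) /\
  (forall s t, 0 <= s < 1 -> 0 <= t < 1 -> gamma s = gamma t -> s = t).

Definition curve (gamma : R -> P) : set P := range gamma.

Definition region (gamma : R -> P) : set P :=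
  curve gamma `|`
  [set p | ~ curve gamma p /\
           plane_bounded (connected_component (~` curve gamma) p)].

Definition crosses_at (gamma delta : R -> P) (t0 : R) : Prop :=
  exists2 e : R, 0 < e &
    ((forall t, t0 - e < t < t0 -> (region delta)^° (gamma t)) /\
     (forall t, t0 < t < t0 + e -> ~ region delta (gamma t))) \/
    ((forall t, t0 - e < t < t0 -> ~ region delta (gamma t)) /\
     (forall t, t0 < t < t0 + e -> (region delta)^° (gamma t))).

(* a nice family, indexed by 'I_n, given by the parametrizations of the
   boundaries *)
Definition nice_family (n : nat) (gam : 'I_n -> R -> P) : Prop :=
  (forall i, jordan_param (gam i)) /\
  (forall i j, i != j -> finite_set (curve (gam i) `&` curve (gam j))) /\
  (forall i j t, i != j -> curve (gam j) (gam i t) -> crosses_at (gam i) (gam j) t) /\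
  (forall i j l p, i != j -> j != l -> i != l ->
     ~ (curve (gam i) p /\ curve (gam j) p /\ curve (gam l) p)).

Definition pseudo_disc_family (n : nat) (gam : 'I_n -> R -> P) : Prop :=
  nice_family gam /\
  (forall i j, i != j -> forall s : seq P, uniq s ->
     (forall p, p \in s -> (curve (gam i) `&` curve (gam j)) p) ->
     (size s <= 2)%N).

Definition depth (n : nat) (gam : 'I_n -> R -> P) (p : P) : nat :=
  #|[set l : 'I_n | p \in region (gam l)]%SET|.

Definition g_vertices (n : nat) (gam : 'I_n -> R -> P) (k : nat) : set P :=
  [set p | (exists i j, i != j /\ curve (gam i) p /\ curve (gam j) p) /\
           (depth gam p <= k)%N].

(* g(F,k) <= b : every duplicate-free list of such vertices has length <= b
   (the vertex set is finite by general position) *)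
Definition g_le (n : nat) (gam : 'I_n -> R -> P) (k b : nat) : Prop :=
  forall s : seq P, uniq s -> (forall p, p \in s -> g_vertices gam k p) ->
    (size s <= b)%N.

End Defs.

(* Main.v *)
Require Import Defs.
From mathcomp Require Import all_boot all_order all_algebra.
From mathcomp Require Import all_classical all_reals all_analysis.
From mathcomp Require Import lra zify.
Import numFieldNormedType.Exports.
Import Order.TTheory GRing.Theory Num.Theory.
Local Open Scope classical_set_scope.
Local Open Scope ring_scope.

Set Implicit Arguments.
Unset Strict Implicit.
Unset Printing Implicit Defensive.

(** Move from [O] along a ray and let [x_A] be the first point of the boundary
of the disc [A] that is met.  If [x_A] is met no later than [x_B], then [x_A]
belongs to [B].  In that case charge a crossing of the boundaries of [A] and [B]
to the boundary of [A], traversed from [x_A] in the direction in which it leaves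
[B] at the crossing.  As the two curves cross at most twice, [A] traversed this
way stays in [B] from [x_A] up to the crossing, and [B] accounts for no other
charge in this direction.  Among the crossings of depth at most [k] charged to
[A] in one direction, the first one therefore lies in [A] and in all the discs
[B] accounting for these charges, hence there are at most [k - 1] of them. *)

Lemma leq_size_cover (I : finType) (T : eqType) (r : I -> pred T) (s : seq T)
    (m : nat) :
  (forall x, x \in s -> exists i, r i x) ->
  (forall i, (count (r i) s <= m)%N) ->
  (size s <= #|I| * m)%N.
Proof.
move=> cover fiber; rewrite -sum_nat_const.
apply: (@leq_trans (\sum_i count (r i) s)); last exact: leq_sum.
rewrite (eq_bigr (fun i => \sum_(x <- s) r i x)%N) => [|i _]; last first.
  by rewrite -sumn_count sumnE big_map.
rewrite exchange_big -sum1_size /= !big_seq; apply: leq_sum => x /cover[i rix].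
by rewrite (bigD1 i) //= rix.
Qed.

Lemma seq_argmin d (T : eqType) (U : orderType d) (f : T -> U) (s : seq T) :
  s != [::] -> exists2 x, x \in s & {in s, forall y, (f x <= f y)%O}.
Proof.
elim: s => // x [_ _|y s /(_ isT)[z zs minz] _].
  by exists x => [|y]; rewrite inE // => /eqP ->.
have [xz|/ltW zx] := leP (f x) (f z).
  exists x; first exact: mem_head.
  by move=> w /predU1P[-> //|/minz]; apply: le_trans.
by exists z => [|w /predU1P[-> //|/minz]]; rewrite // inE zs orbT.
Qed.

Section Plane.
Variable R : realType.
Implicit Types (f g d : R -> (R * R)%type) (p q : (R * R)%type) (c s t u : R).

Lemma jordan_periodz g t (m : int) :
  jordan_param g -> g (t + m%:~R) = g t.
Proof.
move=> [_ [per _]].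
case: m => m; first exact: (periodicn per).
by rewrite NegzE -(periodicn per m.+1 (t + _)) mulrNz subrK.
Qed.

Lemma jordan_surj g c p : jordan_param g -> curve g p ->
  exists2 t, c <= t < c + 1 & g t = p.
Proof.
move=> jg [u _ <-]; exists (u + (- Num.floor (u - c))%:~R).
  by have := floor_itv (u - c); rewrite intrD mulrNz; lra.
exact: jordan_periodz.
Qed.

Lemma jordan_inj g s t : jordan_param g -> `|s - t| < 1 -> g s = g t -> s = t.
Proof.
move=> jg st gst; have [_ [_ inj]] := jg.
have fracE : s + (- Num.floor s)%:~R = t + (- Num.floor t)%:~R.
  apply: inj; last by rewrite !jordan_periodz.
  - by have := floor_itv s; rewrite intrD mulrNz; lra.
  - by have := floor_itv t; rewrite intrD mulrNz; lra.
have stE : s - t = (Num.floor s - Num.floor t)%:~R.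
  by move: fracE; rewrite intrB !mulrNz; lra.
apply/eqP; rewrite -subr_eq0; apply: contraTT st => nst; rewrite -leNgt.
by apply: norm_intr_ge1 => //; rewrite stE intr_int.
Qed.

Lemma curve_closed g : jordan_param g -> closed (curve g).
Proof.
move=> jg; apply: compact_closed; first exact: norm_hausdorff.
suff -> : curve g = g @` `[0, 1].
  apply: continuous_compact; last exact: segment_compact.
  by apply: continuous_subspaceT; case: jg.
apply/seteqP; split=> [p /(jordan_surj 0 jg)[t t01 <-]|_ [t _ <-]].
  by exists t => //; rewrite /= in_itv /=; lra.
by exists t.
Qed.

Lemma continuous_image_component f (i : interval R) (A : set (R * R)) s :
  continuous f -> s \in i -> f @` [set` i] `<=` A ->
  f @` [set` i] `<=` connected_component A (f s).
Proof.
move=> cf si fiA; apply: connected_component_max => //.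
apply: connected_continuous_connected; last exact: continuous_subspaceT.
exact/connected_intervalP/interval_is_interval.
Qed.

Lemma path_meets_curve d f (i : interval R) s t : continuous f ->
  s \in i -> t \in i -> region d (f s) -> ~ region d (f t) ->
  exists2 u, u \in i & curve d (f u).
Proof.
move=> cf si ti ds ndt; apply: contrapT => avoid.
have off : f @` [set` i] `<=` ~` curve d.
  by move=> _ [u ui <-] du; apply: avoid; exists u.
have comp : connected_component (~` curve d) (f s) (f t).
  by apply: (continuous_image_component cf si off); exists t.
apply: ndt; right; split; first by apply: off; exists t.
rewrite -(same_connected_component comp); case: ds => [ds|[]//].
by case: avoid; exists s.
Qed.

Lemma unbounded_path_meets_curve d f : continuous f ->
  ~ plane_bounded (f @` `[0, +oo[) -> region d (f 0) ->
  exists2 t, 0 <= t & curve d (f t).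
Proof.
move=> cf unb d0; apply: contrapT => avoid.
have off : f @` `[0, +oo[ `<=` ~` curve d.
  move=> _ [u /= + <-] du; rewrite in_itv /= andbT => u0.
  by apply: avoid; exists u.
have i0 : (0 : R) \in `[0, +oo[ by rewrite in_itv /= lexx.
case: d0 => [d0|[_ [M bM]]]; first by apply: avoid; exists 0.
apply: unb; exists M => p fp.
exact/bM/(continuous_image_component cf i0 off).
Qed.

Lemma first_hit d f : closed (curve d) -> continuous f ->
  ~ plane_bounded (f @` `[0, +oo[) -> region d (f 0) ->
  exists t, [/\ 0 <= t, curve d (f t) &
    forall u, 0 <= u <= t -> region d (f u)].
Proof.
move=> cld cf unb d0; pose S := `[0, +oo[ `&` f @^-1` curve d.
have S_nonempty : S !=set0.
  have [t t0 dt] := unbounded_path_meets_curve cf unb d0.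
  by exists t; split=> //; rewrite /= in_itv /= t0.
have S_closed : closed S.
  apply: closedI; first exact: rray_closed.
  by apply: closed_comp => // x _; apply: cf.
have S_lbound : lbound S 0 by move=> u [/=]; rewrite in_itv /= andbT.
have infS_le : lbound S (inf S) by apply: ge_inf; exists 0.
have [/= infS0 dinf] : S (inf S).
  apply: (itv_closed_infimums S_nonempty S_closed).
  by split=> // u; exact: lb_le_inf.
exists (inf S); split=> //; first by rewrite in_itv /= andbT in infS0.
move=> u /andP[u0 ui]; apply: contrapT => ndu.
have [||v + dv] := path_meets_curve (i := `[0, u]) cf _ _ d0 ndu;
  [by rewrite in_itv /=; lra..|rewrite in_itv /= => /andP[v0 vu]].
have iv : inf S <= v by apply: infS_le; split; rewrite //= in_itv /= v0.
by apply: ndu; left; have <- : v = u by lra.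
Qed.

Definition ray p t : (R * R)%type := (p.1 + t, p.2).

Lemma ray_continuous p : continuous (ray p).
Proof.
move=> t; apply: (@cvg_pair _ _ _ _ (nbhs (p.1 + t)) (nbhs p.2) _ _ _
  (fun u => p.1 + u) (fun=> p.2)); last exact: cvg_cst.
by apply: cvgD; [exact: cvg_cst|exact: cvg_id].
Qed.

Lemma ray_unbounded p : ~ plane_bounded (ray p @` `[0, +oo[).
Proof.
move=> [M /(_ (ray p (`|M| + `|p.1| + 1)))[|/= + _]].
  by exists (`|M| + `|p.1| + 1) => //; rewrite /= in_itv /= andbT !addr_ge0.
by have := ler_norm M; have := ler_norm (- p.1); rewrite normrN ler_norml; lra.
Qed.

Lemma boundary_points_total n (gam : 'I_n -> R -> (R * R)%type) p :
  (forall i, jordan_param (gam i)) -> (forall i, region (gam i) p) ->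
  exists c : 'I_n -> R, forall i j,
    region (gam j) (gam i (c i)) \/ region (gam i) (gam j (c j)).
Proof.
move=> jor inp.
have hit i : exists ct : R * R, [/\ 0 <= ct.2, gam i ct.1 = ray p ct.2 &
    forall u, 0 <= u <= ct.2 -> region (gam i) (ray p u)].
  have inp0 : region (gam i) (ray p 0).
    by rewrite /ray addr0 -surjective_pairing; exact: inp.
  have [t [t0 [c _ cE] before]] := first_hit (curve_closed (jor i))
    (@ray_continuous p) (@ray_unbounded p) inp0.
  by exists (c, t).
have [ct ctP] := fin_all_exists hit.
exists (fun i => (ct i).1) => i j.
have [ti0 -> regi] := ctP i; have [tj0 -> regj] := ctP j.
have [ij|/ltW ji] := leP (ct i).2 (ct j).2.
- by left; apply: regj; rewrite ti0.
- by right; apply: regi; rewrite tj0.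
Qed.

Definition exit_time g d t : Prop :=
  curve d (g t) /\
  \forall e \near 0^'+, region d (g (t - e)) /\ ~ region d (g (t + e)).

Definition exit_point g d p : Prop := exists2 t, exit_time g d t & g t = p.

Definition meet_at_most_twice g d : Prop :=
  forall s : seq (R * R), uniq s ->
    (forall p, p \in s -> (curve g `&` curve d) p) -> (size s <= 2)%N.

Definition traverse g c (b : bool) t : (R * R)%type :=
  g (if b then c + t else c - t).

Lemma traverse0 g c b : traverse g c b 0 = g c.
Proof. by rewrite /traverse; case: b; rewrite ?addr0 ?subr0. Qed.

Lemma curve_traverse g c b : curve (traverse g c b) = curve g.
Proof.
apply/seteqP; split=> [_ [t _ <-]|_ [t _ <-]]; first by eexists.
exists (if b then t - c else c - t) => //.
by rewrite /traverse; congr (g _); case: b; lra.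
Qed.

Lemma jordan_traverse g c b : jordan_param g -> jordan_param (traverse g c b).
Proof.
move=> jg; have [cg _] := jg; split; last split.
- move=> t; apply: continuous_comp; last exact: cg.
  by case: b; [apply: cvgD|apply: cvgB] => //; exact: cvg_cst.
- move=> t; rewrite /traverse; case: b.
    by rewrite addrA (jordan_periodz _ 1).
  by rewrite opprD addrA -(jordan_periodz _ 1 jg) subrK.
- move=> s t s01 t01 /(jordan_inj jg); case: b => st.
  + by apply: (addrI c); apply: st; rewrite ltr_norml; lra.
  + by apply/oppr_inj/(addrI c); apply: st; rewrite ltr_norml; lra.
Qed.

Lemma nbhs_right0_oo c : 0 < c -> \forall e \near 0^'+, 0 < e < c.
Proof.
move=> c0; apply: filterS2 (nbhs_right_gt 0) (nbhs_right_lt c0).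
by move=> e -> ->.
Qed.

Lemma crosses_exit_point g d c t : curve d (g t) -> crosses_at g d t ->
  exists b, exit_point (traverse g c b) d (g t).
Proof.
move=> dt [e0 /nbhs_right0_oo small [[inl outr]|[outl inr]]].
- exists true; exists (t - c); last by rewrite /traverse addrC subrK.
  split; first by rewrite /traverse addrC subrK.
  apply: filterS small => e e_small.
  by split; [apply: interior_subset; apply: inl|apply: outr] => /=; lra.
- exists false; exists (c - t); last by rewrite /traverse subKr.
  split; first by rewrite /traverse subKr.
  apply: filterS small => e e_small.
  by split; [apply: interior_subset; apply: inr|apply: outl] => /=; lra.
Qed.

Lemma path_meets_curve_before_exit g d s t : continuous g -> s < t ->
  exit_time g d t -> ~ region d (g s) -> exists2 u, s < u < t & curve d (g u).
Proof.
move=> cg st [_ ext] nds.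
have /nbhs_right0_oo small : 0 < t - s by lra.
have [e [[in_t _] e_small]] := filter_ex (filterI ext small).
have [||u + du] := path_meets_curve (i := `[s, t[) cg _ _ in_t nds;
  [by rewrite in_itv /=; lra..|rewrite in_itv /= => /andP[su ut]].
exists u => //; rewrite ut andbT lt_neqAle su andbT.
by apply: contra_notN nds => /eqP ->; left.
Qed.

Section TwoCurves.
Variables g d : R -> (R * R)%type.
Hypothesis jg : jordan_param g.

Lemma exit_point_time c p : exit_point g d p ->
  exists t, [/\ c <= t < c + 1, g t = p & exit_time g d t].
Proof.
move=> [u [du exu] <-]; pose m := - Num.floor (u - c).
exists (u + m%:~R); split.
- by have := floor_itv (u - c); rewrite intrD mulrNz; lra.
- exact: jordan_periodz.
- split; first by rewrite jordan_periodz.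
  by apply: filterS exu => e; rewrite !(addrAC u m%:~R) !jordan_periodz.
Qed.

Hypothesis meet2 : meet_at_most_twice g d.

Lemma no_three_meets s t u : s < t -> t < u -> u < s + 1 ->
  curve d (g s) -> curve d (g t) -> ~ curve d (g u).
Proof.
move=> st tu us ds dt du.
have neq v w : v < w -> w < v + 1 -> (g v == g w) = false.
  move=> vw wv; apply/eqP => /(jordan_inj jg) vwE.
  by suff : v = w; [lra|apply: vwE; rewrite ltr_norml; lra].
have meets p : p \in [:: g s; g t; g u] -> (curve g `&` curve d) p.
  by rewrite !inE => /or3P[] /eqP ->; split=> //; eexists.
have distinct : uniq [:: g s; g t; g u] by rewrite /= !inE !neq //; lra.
by have := meet2 distinct meets.
Qed.

(* [g] is outside [d] right after its first exit and inside [d] right before the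
   second one, so it would have to enter [d] at a third common point. *)
Lemma exit_point_unique p q : exit_point g d p -> exit_point g d q -> p = q.
Proof.
move=> [s [ds exs] <-] /(exit_point_time s)[t [st <- ext]].
have [->//|nst] := eqVneq s t; exfalso.
have lst : s < t by rewrite lt_neqAle nst; lra.
have /nbhs_right0_oo small : 0 < t - s by lra.
have [e [[_ out_s] e_small]] := filter_ex (filterI exs small).
have lset : s + e < t by lra.
have [u ut du] := path_meets_curve_before_exit (proj1 jg) lset ext out_s.
by apply: (no_three_meets _ _ _ ds du (proj1 ext)); lra.
Qed.

Lemma arc_to_exit_point p : region d (g 0) -> exit_point g d p ->
  exists t, [/\ 0 <= t, g t = p & forall u, 0 <= u <= t -> region d (g u)].
Proof.
move=> d0 /(exit_point_time 0)[t [t01 <- ext]].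
exists t; split=> //; first lra.
move=> u /andP[u0]; rewrite le_eqVlt => /predU1P[->|ut].
  by left; case: ext.
apply: contrapT => ndu; have [cg _] := jg.
have [||v + dv] := path_meets_curve (i := `[0, u]) cg _ _ d0 ndu;
  [by rewrite in_itv /=; lra..|rewrite in_itv /= => vu].
have [w uwt dw] := path_meets_curve_before_exit cg ut ext ndu.
by apply: (no_three_meets _ _ _ dv dw (proj1 ext)); lra.
Qed.

End TwoCurves.

Section Family.
Variables (n : nat) (gam : 'I_n -> R -> (R * R)%type).

Lemma leq_depth p (js : seq 'I_n) : uniq js ->
  (forall j, j \in js -> region (gam j) p) -> (size js <= depth gam p)%N.
Proof.
move=> ujs inp; rewrite /depth cardE; apply: uniq_leq_size => // j /inp jp.
by rewrite mem_enum !inE.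
Qed.

Lemma size_exit_points_le g i k (s : seq (R * R)) : jordan_param g ->
  curve g `<=` region (gam i) ->
  (forall j, j != i -> meet_at_most_twice g (gam j)) ->
  uniq s -> (forall p, p \in s -> (depth gam p <= k)%N) ->
  (forall p, p \in s -> exists j,
     [/\ j != i, region (gam j) (g 0) & exit_point g (gam j) p]) ->
  (size s <= k - 1)%N.
Proof.
move=> jg gi twice us depths exits.
have [->//|s_nonempty] := eqVneq s [::].
have /boolp.choice[jt jtP] p : exists jt : 'I_n * R, p \in s ->
    [/\ jt.1 != i, exit_point g (gam jt.1) p, 0 <= jt.2, g jt.2 = p &
        forall u, 0 <= u <= jt.2 -> region (gam jt.1) (g u)].
  have [ps|_] := boolP (p \in s); last by exists (i, 0).
  have [j [ji j0 exj]] := exits p ps.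
  have [t [t0 tp arc]] := arc_to_exit_point jg (twice j ji) j0 exj.
  by exists (j, t).
have [p ps pmin] := seq_argmin (fun p => (jt p).2) s_nonempty.
pose discs := i :: [seq (jt q).1 | q <- s].
have discs_uniq : uniq discs.
  rewrite /= map_inj_in_uniq ?us ?andbT.
    by apply/mapP => -[q /jtP[+ _ _ _ _] iE]; rewrite -iE eqxx.
  move=> q r /jtP[qi exq _ _ _] /jtP[_ exr _ _ _] qr; rewrite -qr in exr.
  exact: (exit_point_unique jg (twice _ qi) exq exr).
have discs_p j : j \in discs -> region (gam j) p.
  have [_ _ t0 <- _] := jtP p ps.
  move=> /predU1P[->|/mapP[q qs ->]]; first by apply: gi; eexists.
  by have [_ _ _ _ arc] := jtP q qs; apply: arc; rewrite t0 pmin.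
have := leq_trans (leq_depth discs_uniq discs_p) (depths p ps).
by rewrite /= size_map; lia.
Qed.

Hypothesis pseudo_discs : pseudo_disc_family gam.
Variable c : 'I_n -> R.

Definition charged (x : 'I_n * bool) p : Prop :=
  let g := traverse (gam x.1) (c x.1) x.2 in
  exists j, [/\ j != x.1, region (gam j) (g 0) & exit_point g (gam j) p].

Lemma crossing_charged i j p :
  (forall i j, region (gam j) (gam i (c i)) \/ region (gam i) (gam j (c j))) ->
  i != j -> curve (gam i) p -> curve (gam j) p -> exists x, charged x p.
Proof.
move=> c_total; wlog jc : i j / region (gam j) (gam i (c i)) => [wlog_jc|].
  move=> ij ip jp; have [jc|ic] := c_total i j; first exact: (wlog_jc i j).
  by apply: (wlog_jc j i); rewrite // eq_sym.
move=> ij [t _ <-] jt; have [[_ [_ [cross _]]] _] := pseudo_discs.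
have [b exb] := crosses_exit_point (c i) jt (cross i j t ij jt).
by exists (i, b), j; rewrite eq_sym traverse0.
Qed.

Lemma size_charged_le x k (s : seq (R * R)) : uniq s ->
  (forall p, p \in s -> (depth gam p <= k)%N /\ charged x p) ->
  (size s <= k - 1)%N.
Proof.
move=> us sP; have [[jor _] meet2] := pseudo_discs.
apply: (@size_exit_points_le (traverse (gam x.1) (c x.1) x.2) x.1) us _ _.
- exact: jordan_traverse.
- by rewrite curve_traverse => p xp; left.
- move=> j jx; rewrite /meet_at_most_twice curve_traverse.
  by apply: meet2; rewrite eq_sym.
- by move=> p /sP[].
- by move=> p /sP[].
Qed.

End Family.
End Plane.

Theorem theorem3 (R : realType) (n : nat) (gam : 'I_n -> R -> (R * R)%type)
  (O : (R * R)%type) (k : nat) :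
  pseudo_disc_family gam ->
  (forall i, (region (gam i))^° O) ->
  (1 <= k)%N ->
  g_le gam k (2 * (k - 1) * n)%N.
Proof.
move=> discs intO _ s us vertex; have [[jor _] _] := discs.
have inO i : region (gam i) O := interior_subset (intO i).
have [c c_total] := boundary_points_total jor inO.
have -> : (2 * (k - 1) * n = #|{: 'I_n * bool}| * (k - 1))%N.
  by rewrite card_prod card_ord card_bool; lia.
apply: (leq_size_cover (r := fun x p => `[< charged gam c x p >])).
- move=> p /vertex[[i [j [ij [ip jp]]]] _].
  have [x xp] := crossing_charged discs c_total ij ip jp.
  by exists x; apply/asboolP.
- move=> x; rewrite -size_filter.
  apply: (size_charged_le discs (c := c) (x := x)); first exact: filter_uniq.
  by move=> p; rewrite mem_filter => /andP[/asboolP xp /vertex[]].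
Qed.
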